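(* Let $(S_i)_{i\geq 0}$ be an infinite sequence of numerical semigroups such that for each $i$, $S_i=S_{i+1}\cup\{F(S_{i+1})\}$, and such that for at least one $i$ we have $m(S_i)<F(S_i)$. Then the sequence of types $t(S_i)$ is eventually constant.
   Context: $\mathbb{N}=\{0,1,2,\dots\}$. A numerical semigroup is a subset $S\subseteq\mathbb{N}$ containing $0$, closed under addition, with finite complement in $\mathbb{N}$. The elements of $\mathbb{N}\setminus S$ are the gaps of $S$; for $S\neq\mathbb{N}$ the Frobenius number $F(S)$ is the largest gap (so in the sequence $S_{i+1}\neq\mathbb{N}$ for all $i$; $F(\mathbb{N})=-1$ by convention); the multiplicity $m(S)$ is the smallest nonzero element of $S$. The set of pseudo-Frobenius numbers is $PF(S)=\{x\in\mathbb{N}\setminus S \mid x+s\in S \text{ for all } s\in S\setminus\{0\}\}$, and the type is $t(S)=|PF(S)|$. *)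

(* Defs.v *)
From mathcomp Require Import all_boot all_order all_algebra finmap.
From mathcomp Require Import all_classical.

Set Implicit Arguments.
Unset Strict Implicit.
Unset Printing Implicit Defensive.

Import Order.TTheory GRing.Theory Num.Theory.

Local Open Scope classical_set_scope.

Definition gaps (S : set nat) : set nat := ~` S.

Record numerical_semigroup (S : set nat) : Prop := NumericalSemigroup {
  numsg_zero : S 0;
  numsg_add : forall x y, S x -> S y -> S (x + y);
  numsg_cofinite : finite_set (gaps S)
}.

(* Integer-valued because of the convention F(N) = -1, which is the default
   value of xget, reached exactly when there is no largest gap. *)
Definition frobenius (S : set nat) : int :=
  xget (- 1)%R
    [set Posz f | f in [set f | gaps S f /\ forall x, gaps S x -> x <= f]].

(* The default value 0 is not reached on a numerical semigroup. *)
Definition multiplicity (S : set nat) : nat :=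
  xget 0 [set m | [/\ S m, m <> 0 & forall x, S x -> x <> 0 -> m <= x]].

Definition pseudo_frobenius (S : set nat) : set nat :=
  [set x | gaps S x /\ forall s, S s -> s <> 0 -> S (x + s)].

(* fset_set is the junk value fset0 only on infinite sets; here the set is
   included in the gaps of S, hence finite for a numerical semigroup. *)
Definition semigroup_type (S : set nat) : nat :=
  #|` fset_set (pseudo_frobenius S)|.

(* S = T `|` [set F(T)], read in the integers since F(T) is one. As -1 is not
   in the left-hand side, this forces T to be different from N. *)
Definition adds_frobenius (S T : set nat) : Prop :=
  Posz @` S = Posz @` T `|` [set frobenius T].

(* Main.v *)
Require Import Defs.
From mathcomp Require Import all_boot all_order all_algebra finmap.
From mathcomp Require Import all_classical.
From mathcomp Require Import zify.

(** Let [T] be the intersection of the [S i]. The Frobenius numbers [F] are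
    strictly increasing, so [S i] is [T] together with all integers above its
    Frobenius number, and the hypothesis on the multiplicity provides a nonzero
    element in [T]; let [m] be the smallest one. As [T] is stable under adding
    [m], membership in [T] is [m]-periodic from some [b] on. For [F] large, a
    pseudo-Frobenius number [x] of [T] completed above [F] either lies in the
    window [F - m < x <= F], where every gap is pseudo-Frobenius and the number
    of gaps does not depend on [F] by periodicity, or satisfies [x < b]; in the
    latter range the condition on [x] only gets stronger as [F] grows, hence
    stabilizes. *)

Lemma eventually_forall_ltn (n : nat) (Q : nat -> nat -> Prop) :
  (forall r, r < n -> exists b, forall x, b <= x -> Q r x) ->
  exists b, forall r x, r < n -> b <= x -> Q r x.
Proof.
elim: n => [|n IHn] evQ; first by exists 0.
have [r rn|b bQ] := IHn; first by apply: evQ; lia.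
have [c cQ] := evQ n (ltnSn n).
exists (maxn b c) => r x; rewrite ltnS leq_eqVlt geq_max.
by case/predU1P => [->|rn] /andP[bx cx]; [exact: cQ | exact: bQ].
Qed.

Lemma card_fset_set_count (A : set nat) (n : nat) :
  (forall x, A x -> x < n) ->
  #|` fset_set A| = count (fun x => `[< A x >]) (iota 0 n).
Proof.
move=> ltA.
have finA : finite_set A.
  by apply: (sub_finite_set _ (finite_II n)) => x /ltA.
rewrite -size_filter; apply/perm_size/uniq_perm.
- exact: fset_uniq.
- exact/filter_uniq/iota_uniq.
- move=> x; rewrite mem_filter mem_iota in_fset_set// add0n /=.
  apply/idP/andP => [/set_mem Ax|[/asboolP Ax _]]; last exact/mem_set.
  by split; [exact/asboolP | exact: ltA].
Qed.

(** Sliding the window one step to the right drops [p a] and gains [p (a + m)], which agree. *)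
Lemma count_iota_periodic (p : pred nat) (m b : nat) :
  (forall x, b <= x -> p (x + m) = p x) ->
  forall a, b <= a -> count p (iota a m) = count p (iota b m).
Proof.
move=> perp; elim=> [|a IHa]; first by rewrite leqn0 => /eqP->.
rewrite leq_eqVlt ltnS => /predU1P[->//|ba]; rewrite -IHa //.
suff: count p (iota a m.+1) = p a + count p (iota a m).
  by rewrite /= => /eqP; rewrite eqn_add2l => /eqP.
by rewrite -addn1 iotaD count_cat /= addn0 perp// addnC.
Qed.

Lemma frobeniusP (S : set nat) (f : nat) :
  frobenius S = Posz f -> ~ S f /\ forall x, ~ S x -> x <= f.
Proof.
rewrite /frobenius; case: xgetP => [z -> [g [gS gmax] <-] [<-]|_ //].
by split.
Qed.

Lemma multiplicityP (S : set nat) (x : nat) : S x -> x <> 0 ->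
  [/\ S (multiplicity S), multiplicity S <> 0 &
      forall y, S y -> y <> 0 -> multiplicity S <= y].
Proof.
move=> Sx x0; rewrite /multiplicity; case: xgetP => [y -> [] //|noy].
have exS : exists n, `[< S n /\ n <> 0 >] by exists x; apply/asboolP.
case: (ex_minnP exS) => n /asboolP[Sn n0] minn.
case: (noy n); split=> // y Sy y0; apply: minn; exact/asboolP.
Qed.

(** [frobenius T] lies in the image of [S] under [Posz], so it is not the default [-1]. *)
Lemma adds_frobeniusP (S T : set nat) : adds_frobenius S T ->
  exists f, frobenius T = Posz f /\ forall x, S x <-> T x \/ x = f.
Proof.
rewrite /adds_frobenius => ST.
have [f Sf fE] : (Posz @` S)%classic (frobenius T) by rewrite ST; right.
exists f; split=> // x; split=> [Sx|[Tx|-> //]].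
- have : (Posz @` S)%classic (Posz x) by exists x.
  by rewrite ST => -[[y Ty [<-]]|]; [left | rewrite /= -fE => -[->]; right].
- have : (Posz @` S)%classic (Posz x) by rewrite ST; left; exists x.
  by case=> y Sy [<-].
Qed.

(** A residue class modulo [m] either misses [T] or lies in [T] from any of its members [w] on; [b]
    bounds such a [w] over the finitely many classes. *)
Lemma eventually_periodic_monoid (T : set nat) (m : nat) :
  (forall x y, T x -> T y -> T (x + y)) -> T 0 -> T m -> m <> 0 ->
  exists b, forall x, b <= x -> T (x + m) <-> T x.
Proof.
move=> addT T0 Tm m0.
have Tmul k : T (k * m) by elim: k => // k; rewrite mulSn; exact: addT.
suff [b bP] : exists b, forall r x, r < m -> b <= x ->
    x %% m = r -> T (x + m) -> T x.
  exists b => x bx; split=> [|Tx]; last exact: addT.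
  by apply: (bP (x %% m)) => //; rewrite ltn_mod; lia.
apply: eventually_forall_ltn => r rm.
have [[w [Tw wr]]|now] := pselect (exists w, T w /\ w %% m = r).
- exists w => x wx xr _.
  have dvd : m %| x - w by rewrite -eqn_mod_dvd // xr wr.
  by rewrite -(subnKC wx); case/dvdnP: dvd => k ->; exact: addT.
- exists 0 => x _ xr Txm; case: now; exists (x + m).
  by rewrite modnDr.
Qed.

Definition complete_above (T : set nat) (F : nat) : set nat :=
  [set x | T x \/ F < x]%classic.

Lemma type_complete_above (T : set nat) (m : nat) :
  (forall x y, T x -> T y -> T (x + y)) -> T 0 -> T m -> m <> 0 ->
  (forall s, T s -> s <> 0 -> m <= s) ->
  exists N t, forall F, N <= F -> semigroup_type (complete_above T F) = t.
Proof.
move=> addT T0 Tm m0 minm.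
have [b perT] := eventually_periodic_monoid _ _ addT T0 Tm m0.
pose stable x := ~ T x /\ forall s, T s -> s <> 0 -> T (x + s).
have [c cP] : exists c, forall x F, x < b -> c <= F ->
    pseudo_frobenius (complete_above T F) x <-> stable x.
  apply: eventually_forall_ltn => x xb.
  have [stx|nstx] := pselect (stable x).
    (* As [x < b <= F], [x] remains a gap, while any [s] beyond [F] sends [x + s] beyond [F]. *)
    exists b => F bF; split=> // _.
    case: stx => nTx stx; split=> [[//|]|]; first lia.
    by move=> s [Ts s0|]; [left; exact: stx | right; lia].
  have [Tx|nTx] := pselect (T x).
    by exists 0 => F _; split=> [[nC _]|[]//]; case: nC; left.
  have [s [Ts s0 nTxs]] : exists s, [/\ T s, s <> 0 & ~ T (x + s)].
    apply: contrapT => nos; apply: nstx; split=> // s Ts s0.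
    by apply: contrapT => nTxs; apply: nos; exists s.
  (* Once [F] reaches [x + s], this sum is a gap of the completion too, so [s] keeps refuting the
     condition. *)
  exists (x + s) => F xsF; split=> // -[_ /(_ s (or_introl Ts) s0)].
  by case=> //; lia.
exists (maxn c (b + m)),
  (count (fun x => `[< stable x >]) (iota 0 b) +
   count (fun x => `[< ~ T x >]) (iota b m)) => F.
rewrite geq_max => /andP[cF bmF]; rewrite /semigroup_type.
rewrite (card_fset_set_count _ F.+1); last first.
  by move=> x [nC _]; rewrite ltnS leqNgt; apply/negP => Fx; apply: nC; right.
(* Three ranges: below [b], a middle one, and the last [m] integers up to [F]. *)
have -> : F.+1 = b + (F.+1 - m - b) + m by lia.
rewrite !iotaD !count_cat add0n.
have -> : b + (F.+1 - m - b) = F.+1 - m by lia.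
congr (_ + _).
  rewrite [X in _ + X](_ : _ = 0) ?addn0.
    apply: eq_in_count => x; rewrite mem_iota => xb.
    by apply: asbool_equiv_eq; apply: cP => //; lia.
  (* The middle range contributes nothing: for a gap [x] there, [x + m <= F] is again a gap by
     periodicity, so [m] refutes the condition. *)
  apply/eqP; rewrite -leqn0 leqNgt -has_count; apply/hasPn => x.
  rewrite mem_iota => xI; apply/asboolPn => -[nC /(_ m (or_introl Tm) m0)].
  case=> [|]; last by lia.
  by rewrite perT => [Tx|]; [apply: nC; left | lia].
rewrite -(count_iota_periodic _ m b _ (F.+1 - m)); last 2 first.
- by move=> x bx; apply/asbool_equiv_eq/not_iff_compat/perT.
- by lia.
(* In the last window every gap qualifies: a nonzero [s] is at least [m], so [x + s] exceeds [F]. *)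
apply: eq_in_count => x; rewrite mem_iota => xI; apply: asbool_equiv_eq.
split=> [[nC _] Tx|nTx]; first by apply: nC; left.
split=> [[//|]|s [Ts|] s0]; first lia; last by right; lia.
by right; have := minm s Ts s0; lia.
Qed.

Theorem theorem1p5 (S : nat -> set nat)
  (S_numsg : forall i : nat, numerical_semigroup (S i))
  (S_step : forall i : nat, adds_frobenius (S i) (S i.+1))
  (S_mult : exists i : nat, (Posz (multiplicity (S i)) < frobenius (S i))%R) :
  exists N t : nat, forall i : nat, N <= i -> semigroup_type (S i) = t.
Proof.
have [f fP] := choice (fun i => adds_frobeniusP _ _ (S_step i)).
have gapf i : ~ S i.+1 (f i) by have [/frobeniusP[]] := fP i.
have maxf i x : f i < x -> S i.+1 x.
  move=> fx; apply: contrapT; have [/frobeniusP[_ fmax] _] := fP i.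
  by move/fmax; lia.
have SE i x : S i x <-> S i.+1 x \/ x = f i by have [] := fP i.
have ltf i : f i < f i.+1.
  have Sf : S i.+1 (f i.+1) by apply/SE; right.
  rewrite ltnNge; apply/negP; rewrite leq_eqVlt => /orP[/eqP ff|lff].
    by apply: (gapf i); rewrite -ff.
  by apply: (gapf i); apply/SE; left; exact: maxf.
have lef i k : f i + k <= f (i + k).
  elim: k => [|k IHk]; first by rewrite !addn0.
  by have := ltf (i + k); rewrite !addnS; lia.
pose T : set nat := fun x => forall i, S i x.
have TE i : S i.+1 = complete_above T (f i).
  apply/seteqP; split=> x; last by case=> [/(_ i.+1)|/maxf].
  move=> Sx; have [xf|] := leqP x (f i); [left=> j | by right].
  (* Later steps remove only Frobenius numbers larger than [f i], hence never [x]; earlier terms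
     contain later ones. *)
  have up k : S (i.+1 + k) x.
    elim: k => [|k]; first by rewrite addn0.
    rewrite addnS => /SE[//|xE].
    by have := lef i k.+1; rewrite -[i + _]addSnnS -xE; lia.
  have down k : S k x -> forall j, j <= k -> S j x.
    elim: k => [Sk l|k IHk Sk l]; first by rewrite leqn0 => /eqP->.
    have Sl := IHk ((SE k x).2 (or_introl Sk)).
    by rewrite leq_eqVlt => /predU1P[->|/Sl].
  by apply: (down _ (up j)); lia.
have addT x y : T x -> T y -> T (x + y).
  by move=> Tx Ty i; exact: (numsg_add (S_numsg i)).
have T0 : T 0 by move=> i; apply: numsg_zero.
have [x Tx x0] : exists2 x, T x & x <> 0.
  have [i mi] := S_mult.
  have Sf : S i (f i) by apply/SE; right.
  have f0 : f i <> 0 by move=> f0; apply: (gapf i); rewrite f0; exact: T0.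
  have [Sm m0 _] := multiplicityP _ _ Sf f0.
  (* The multiplicity is below [F(S i)], itself at most [f i], so it survives in [S i.+1]; not lying
     above [f i], it belongs to [T]. *)
  exists (multiplicity (S i)) => //.
  case E : (frobenius (S i)) mi => [g|//]; rewrite ltz_nat => mg.
  have [gapg _] := frobeniusP _ _ E.
  have gf : g <= f i.
    rewrite leqNgt; apply/negP => fg; apply: gapg; apply/SE; left; exact: maxf.
  by move: Sm => /SE[|]; [rewrite TE => -[//|]; lia | lia].
have [Tm m0 minm] := multiplicityP _ _ Tx x0.
have [N [t Nt]] := type_complete_above _ _ addT T0 Tm m0 minm.
(* The index shifts by one because [f i] is the Frobenius number of [S i.+1]; strict growth gives
   [i <= f i]. *)
exists N.+1, t => -[//|i] Ni; rewrite TE; apply: Nt.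
by have := lef 0 i; rewrite add0n; lia.
Qed.
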